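(* Let $\mathcal C$ be an $\mathcal M$-category. (i) The functor $s:\mathcal C\to\mathrm{cat}(\mathcal M,\mathcal C)$ is a morphism of $\mathcal M$-categories. (ii) The $\mathcal M$-category $\mathrm{cat}(\mathcal M,\mathcal C)$ is saturated. (iii) If $\mathcal C$ is tame, then the inclusion $\mathcal C^{\mathrm{sat}}=\mathrm{cat}(\mathcal M,\mathcal C)^\tau\to\mathrm{cat}(\mathcal M,\mathcal C)$ is a global equivalence of $\mathcal M$-categories. (iv) If $\mathcal C$ is tame, then the $\mathcal M$-category $\mathcal C^{\mathrm{sat}}$ is saturated, the functor $s:\mathcal C\to\mathrm{cat}(\mathcal M,\mathcal C)$ takes values in $\mathcal C^{\mathrm{sat}}$, and the restriction $s:\mathcal C\to\mathcal C^{\mathrm{sat}}$ is an equivalence of underlying categories. (v) If $\mathcal C$ is tame and saturated, then $s:\mathcal C\to\mathcal C^{\mathrm{sat}}$ is a global equivalence of $\mathcal M$-categories.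
   Context: Let $\omega=\{0,1,2,\dots\}$ and let $M$ be the monoid, under composition, of injective maps $\omega\to\omega$. For a set $X$, $EX$ denotes the category with object set $X$ and exactly one morphism, written $(y,x):x\to y$, between any two objects. Then $\mathcal M=EM$ is a strict monoidal category. An $\mathcal M$-category is a small category $\mathcal C$ with a strict (strictly associative and unital) action functor $\mathcal M\times\mathcal C\to\mathcal C$; morphisms are functors commuting strictly with the actions. For $u,v\in M$ write $u_*:\mathcal C\to\mathcal C$ for the action of $u$ and $[v,u]^x:u_*(x)\to v_*(x)$ for the isomorphism given by acting with $(v,u)$ on $1_x$. An object $x$ is supported on $A\subseteq\omega$ if $u_*(x)=x$ for every $u\in M$ that is the identity on $A$; it is finitely supported if it is supported on some finite set. $\mathcal C$ is tame if all its objects are finitely supported; in general $\mathcal C^\tau$ denotes the full ($\mathcal M$-stable) subcategory of finitely supported objects. Fix for every countably infinite set $U$ a bijection $\kappa_U:\omega\to U$, with $\kappa_\omega=\mathrm{id}$. For an $\mathcal M$-category $\mathcal C$ put $\mathcal C[U]=\mathcal C$, and let an injection $j:U\to V$ induce $j_*:=(\kappa_V^{-1}j\kappa_U)_*:\mathcal C[U]\to\mathcal C[V]$. If a group $G$ acts on $U$, this makes $\mathcal C[U]$ a category with strict $G$-action. For a finite group $G$, $\omega^G$ is the $G$-set of maps $G\to\omega$ with $(g\cdot f)(h)=f(g^{-1}h)$. $F^G\mathcal C=\mathcal C[\omega^G]^G$ is the category of $G$-fixed objects and morphisms, and $F^{hG}\mathcal C=\mathrm{cat}^G(EG,\mathcal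 C[\omega^G])$ is the category of $G$-equivariant functors and $G$-equivariant natural transformations ($G$ acting on $EG$ by left translation). $\kappa:F^G\mathcal C\to F^{hG}\mathcal C$ sends $x$ to the constant functor at $x$. $\mathcal C$ is saturated if $\kappa$ is an equivalence of categories for every finite group $G$. A morphism $\Phi$ of $\mathcal M$-categories is a global equivalence if for every finite group $G$ the functor $F^G\Phi$ is a weak equivalence of categories (i.e. induces a weak equivalence on nerves). $\mathrm{cat}(\mathcal M,\mathcal C)$ is the category of functors $\mathcal M\to\mathcal C$ and natural transformations, with the following $\mathcal M$-action (the diagonal of the action on $\mathcal M$ by right translation and the action on $\mathcal C$): $u_*(X)(w)=u_*(X(wu))$, $u_*(X)(w,v)=u_*(X(wu,vu))$, $u_*(\Psi)(w)=u_*(\Psi(wu))$, and $[u',u]^X(w)=u'_*(X(wu',wu))\circ[u',u]^{X(wu)}$. The functor $s$ sends an object $x$ to the constant functor $s(x)(w)=x$, $s(x)(w,v)=1_x$, and a morphism $f$ to the constant transformation $s(f)(w)=f$. *)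

(* Defs.v *)
From Stdlib Require Import Relation_Operators.
From mathcomp Require Import all_boot all_fingroup.
From mathcomp Require Import boolp classical_sets functions cardinality.

Set Implicit Arguments.
Unset Strict Implicit.
Unset Printing Implicit Defensive.
#[local] Obligation Tactic := idtac.

Record category := Category {
  ob :> Type;
  hom : ob -> ob -> Type;
  idm : forall x, hom x x;
  comp : forall x y z, hom y z -> hom x y -> hom x z;
  comp1m : forall x y (f : hom x y), comp (idm y) f = f;
  compm1 : forall x y (f : hom x y), comp f (idm x) = f;
  compA : forall x y z t (h : hom z t) (g : hom y z) (f : hom x y),
    comp h (comp g f) = comp (comp h g) f }.

Arguments hom {c} x y.
Arguments idm {c} x.
Arguments comp {c x y z} g f.

Notation "g \oC f" := (comp g f) (at level 50, left associativity).

(** Equality of two morphisms whose sources and targets are not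
    syntactically the same; [eqm f g] entails that the sources are equal and
    that the targets are equal. *)
Inductive eqm (C : category) (x y : C) (f : hom x y) :
  forall x' y' : C, hom x' y' -> Prop := eqm_refl : eqm f f.

Notation "f === g" := (eqm f g) (at level 70, no associativity).

Record functor (C D : category) := Functor {
  fob :> C -> D;
  fmap : forall x y : C, hom x y -> hom (fob x) (fob y);
  fmap1 : forall x, fmap (idm x) = idm (fob x);
  fmapM : forall x y z (g : hom y z) (f : hom x y),
    fmap (g \oC f) = fmap g \oC fmap f }.

Arguments fmap {C D} f {x y} _ : rename.

Record nattrans (C D : category) (F G : functor C D) := NatTrans {
  ntc :> forall x, hom (F x) (G x);
  ntN : forall x y (f : hom x y), ntc y \oC fmap F f = fmap G f \oC ntc x }.

Section EqmTheory.
Variable C : category.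

Lemma eqm_ends (x y x' y' : C) (f : hom x y) (g : hom x' y') :
  f === g -> x = x' /\ y = y'.
Proof. by case: _ _ _ /. Qed.

Lemma eqm_eq (x y : C) (f g : hom x y) : f === g -> f = g.
Proof.
move=> fg.
pose cast x' y' (ex : x = x') (ey : y = y') : hom x' y' :=
  ecast y' (hom x' y') ey (ecast x' (hom x' y) ex f).
suff H x' y' (g' : hom x' y') : f === g' -> forall ex ey, cast x' y' ex ey = g'.
  exact: (H _ _ _ fg erefl erefl).
case: x' y' g' / => ex ey.
by rewrite (Prop_irrelevance ex erefl) (Prop_irrelevance ey erefl).
Qed.

Lemma eqm_sym (x y x' y' : C) (f : hom x y) (g : hom x' y') :
  f === g -> g === f.
Proof. by case: _ _ _ /. Qed.

Lemma eqm_trans (x y x' y' x'' y'' : C)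
    (f : hom x y) (g : hom x' y') (h : hom x'' y'') :
  f === g -> g === h -> f === h.
Proof. by case: _ _ _ /. Qed.

Lemma eqm_of_eq (x y : C) (f g : hom x y) : f = g -> f === g.
Proof. by move->. Qed.

Lemma eqm_id (x y : C) : x = y -> idm x === idm y.
Proof. by move->. Qed.

Lemma eqm_comp (x y z x' y' z' : C) (g : hom y z) (f : hom x y)
    (g' : hom y' z') (f' : hom x' y') :
  g === g' -> f === f' -> g \oC f === g' \oC f'.
Proof.
move=> gg ff; have [ex ey] := eqm_ends ff; have [_ ez] := eqm_ends gg.
by subst; rewrite (eqm_eq gg) (eqm_eq ff).
Qed.

Lemma eqm_fmap (D : category) (F : functor C D) (x y x' y' : C)
    (f : hom x y) (g : hom x' y') : f === g -> fmap F f === fmap F g.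
Proof. by case: _ _ _ /. Qed.

End EqmTheory.

Lemma functor_ext (C D : category) (F G : functor C D) :
  (forall x y (f : hom x y), fmap F f === fmap G f) -> F = G.
Proof.
move=> FG; have Fob : fob F = fob G.
  by apply: funext => x; have [] := eqm_ends (FG x x (idm x)).
case: F G FG Fob => [F mF F1 FM] [G mG G1 GM] /= FG eF; subst G.
have e : mF = mG.
  apply: functional_extensionality_dep => x.
  apply: functional_extensionality_dep => y.
  by apply: funext => f; apply: eqm_eq; exact: FG.
by subst mG; congr Functor; exact: Prop_irrelevance.
Qed.

Lemma nattrans_ext (C D : category) (F G : functor C D) (s t : nattrans F G) :
  (forall x, s x = t x) -> s = t.
Proof.
case: s t => [s sN] [t tN] /= st.
have e : s = t by apply: functional_extensionality_dep.
by subst t; congr NatTrans; exact: Prop_irrelevance.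
Qed.

Definition idF (C : category) : functor C C :=
  @Functor C C id (fun _ _ f => f) (fun _ => erefl) (fun _ _ _ _ _ => erefl).

Program Definition compF (C D E : category) (G : functor D E) (F : functor C D) :
    functor C E :=
  @Functor C E (fun x => G (F x)) (fun _ _ f => fmap G (fmap F f)) _ _.
Next Obligation. by move=> * /=; rewrite !fmap1. Qed.
Next Obligation. by move=> * /=; rewrite !fmapM. Qed.

Program Definition constF (C D : category) (d : D) : functor C D :=
  @Functor C D (fun _ => d) (fun _ _ _ => idm d) _ _.
Next Obligation. by move=> *. Qed.
Next Obligation. by move=> * /=; rewrite comp1m. Qed.

Program Definition constN (C D : category) (x y : D) (f : hom x y) :
    nattrans (constF C x) (constF C y) :=
  @NatTrans C D (constF C x) (constF C y) (fun _ => f) _.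
Next Obligation. by move=> * /=; rewrite compm1 comp1m. Qed.

Program Definition idN (C D : category) (F : functor C D) : nattrans F F :=
  @NatTrans C D F F (fun x => idm (F x)) _.
Next Obligation. by move=> * /=; rewrite comp1m compm1. Qed.

Program Definition compN (C D : category) (F G H : functor C D)
    (t : nattrans G H) (s : nattrans F G) : nattrans F H :=
  @NatTrans C D F H (fun x => t x \oC s x) _.
Next Obligation. by move=> * /=; rewrite -compA ntN compA ntN compA. Qed.

Program Definition functor_cat (C D : category) : category :=
  @Category (functor C D) (@nattrans C D) (@idN C D) (@compN C D) _ _ _.
Next Obligation. by move=> * /=; apply: nattrans_ext => x /=; rewrite comp1m. Qed.
Next Obligation. by move=> * /=; apply: nattrans_ext => x /=; rewrite compm1. Qed.
Next Obligation. by move=> * /=; apply: nattrans_ext => x /=; rewrite compA. Qed.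

Lemma nattrans_eqm (C D : category) (F G F' G' : functor C D)
    (s : nattrans F G) (t : nattrans F' G') :
  F = F' -> G = G' -> (forall x, s x === t x) ->
  @eqm (functor_cat C D) F G s F' G' t.
Proof.
move=> eF eG st; subst; apply/eqm_of_eq/nattrans_ext => x.
exact/eqm_eq/st.
Qed.

Program Definition prod_cat (C D : category) : category :=
  @Category (C * D) (fun p q => (hom p.1 q.1 * hom p.2 q.2)%type)
    (fun p => (idm p.1, idm p.2))
    (fun _ _ _ g f => (g.1 \oC f.1, g.2 \oC f.2)) _ _ _.
Next Obligation. by move=> * /=; rewrite !comp1m -surjective_pairing. Qed.
Next Obligation. by move=> * /=; rewrite !compm1 -surjective_pairing. Qed.
Next Obligation. by move=> * /=; rewrite !compA. Qed.

Program Definition Ecat (X : Type) : category :=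
  @Category X (fun _ _ => unit) (fun _ => tt) (fun _ _ _ _ _ => tt) _ _ _.
Next Obligation. by move=> X x y []. Qed.
Next Obligation. by move=> X x y []. Qed.
Next Obligation. by move=> *. Qed.

(** [Emor y x] is the morphism [(y, x) : x -> y]. *)
Definition Emor (X : Type) (y x : X) : @hom (Ecat X) x y := tt.

Program Definition full_subcat (C : category) (P : C -> Prop) : category :=
  @Category {x : C | P x} (fun x y => hom (sval x) (sval y))
    (fun x => idm (sval x)) (fun _ _ _ g f => g \oC f) _ _ _.
Next Obligation. by move=> * /=; rewrite comp1m. Qed.
Next Obligation. by move=> * /=; rewrite compm1. Qed.
Next Obligation. by move=> * /=; rewrite compA. Qed.

Lemma full_eqm (C : category) (P : C -> Prop) (x y x' y' : full_subcat P)
    (f : @hom C (sval x) (sval y)) (g : @hom C (sval x') (sval y')) :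
  f === g -> @eqm (full_subcat P) x y f x' y' g.
Proof.
case: x y x' y' f g => [x px] [y py] [x' px'] [y' py'] /= f g fg.
have [ex ey] := eqm_ends fg; subst.
rewrite (Prop_irrelevance px' px) (Prop_irrelevance py' py).
by rewrite (eqm_eq fg).
Qed.

Definition full_incl (C : category) (P : C -> Prop) : functor (full_subcat P) C :=
  @Functor (full_subcat P) C (@sval C P) (fun _ _ f => f)
    (fun _ => erefl) (fun _ _ _ _ _ => erefl).

Definition full_corestrict (C D : category) (P : D -> Prop) (F : functor C D)
    (FP : forall x, P (F x)) : functor C (full_subcat P) :=
  @Functor C (full_subcat P) (fun x => exist P (F x) (FP x))
    (fun _ _ f => fmap F f) (@fmap1 _ _ F) (@fmapM _ _ F).

Definition is_iso (C : category) (x y : C) (f : hom x y) : Prop :=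
  exists g : hom y x, g \oC f = idm x /\ f \oC g = idm y.

Definition nat_iso (C D : category) (F G : functor C D) : Prop :=
  exists t : nattrans F G, forall x, is_iso (t x).

Definition is_equivalence (C D : category) (F : functor C D) : Prop :=
  exists G : functor D C, nat_iso (idF C) (compF G F) /\ nat_iso (compF F G) (idF D).

Record monotone (m n : nat) := Monotone {
  mono_fun :> 'I_m.+1 -> 'I_n.+1;
  mono_homo : forall i j : 'I_m.+1, i <= j -> mono_fun i <= mono_fun j }.

Lemma monotone_ext m n (a b : monotone m n) : (forall i, a i = b i) -> a = b.
Proof.
case: a b => [a ha] [b hb] /= ab; have e : a = b by apply: funext.
by subst b; congr Monotone; exact: Prop_irrelevance.
Qed.

Definition mono_id n : monotone n n := @Monotone n n id (fun _ _ h => h).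

Definition mono_comp l m n (b : monotone m n) (a : monotone l m) : monotone l n :=
  @Monotone l n (fun i => b (a i)) (fun _ _ h => mono_homo b (mono_homo a h)).

Record sset := SSet {
  simp :> nat -> Type;
  smap : forall m n, monotone m n -> simp n -> simp m;
  smap1 : forall n (x : simp n), smap (mono_id n) x = x;
  smapM : forall l m n (b : monotone m n) (a : monotone l m) (x : simp n),
    smap (mono_comp b a) x = smap a (smap b x) }.

Record smor (X Y : sset) := SMor {
  sfun :> forall n, X n -> Y n;
  sfunN : forall m n (a : monotone m n) (x : X n),
    sfun (smap a x) = smap a (sfun x) }.

Definition scomp (X Y Z : sset) (g : smor Y Z) (f : smor X Y) : smor X Z.
Proof.
exists (fun n x => g n (f n x)).
by move=> m n a x; rewrite !sfunN.
Defined.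

Definition sprod (X Y : sset) : sset.
Proof.
exists (fun n => (X n * Y n)%type) (fun _ _ a p => (smap a p.1, smap a p.2)).
- by move=> n [x y] /=; rewrite !smap1.
- by move=> l m n b a p; rewrite !smapM.
Defined.

Definition simplex (k : nat) : sset.
Proof.
exists (fun n => monotone n k) (fun _ _ a s => mono_comp s a).
- by move=> n x; apply: monotone_ext.
- by move=> l m n b a x; apply: monotone_ext.
Defined.

(** The simplices of the horn [Lambda^n_k]: those of [Delta^n] that miss a
    vertex other than [k]. *)
Definition in_horn (n : nat) (k : 'I_n.+1) (m : nat) (s : monotone m n) : Prop :=
  exists j, j <> k /\ forall i, s i <> j.

Lemma in_horn_map n (k : 'I_n.+1) l m (a : monotone l m) (s : monotone m n) :
  in_horn k s -> in_horn k (mono_comp s a).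
Proof. by case=> j [jk sj]; exists j; split=> // i; exact: sj. Qed.

Definition horn (n : nat) (k : 'I_n.+1) : sset.
Proof.
exists (fun m => {s : monotone m n | in_horn k s})
       (fun _ _ a s => exist _ (mono_comp (sval s) a) (in_horn_map a (svalP s))).
- by move=> m [s ps]; apply: eq_exist; apply: monotone_ext.
- by move=> l m m' b a [s ps]; apply: eq_exist; apply: monotone_ext.
Defined.

Definition horn_incl (n : nat) (k : 'I_n.+1) : smor (horn k) (simplex n).
Proof. by exists (fun m (x : horn k m) => sval x : simplex n m). Defined.

Definition kan (Z : sset) : Prop :=
  forall (n : nat) (k : 'I_n.+2) (s : smor (horn k) Z),
  exists t : smor (simplex n.+1) Z,
    forall m (x : horn k m), t m (horn_incl k m x) = s m x.

Definition vertex1 (e : 'I_2) n : simplex 1 n :=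
  @Monotone n 1 (fun _ => e) (fun _ _ _ => leqnn e).

(** The edges of the simplicial mapping set [Fun(X, Z)]. *)
Definition shomotopy1 (X Z : sset) (f g : smor X Z) : Prop :=
  exists h : smor (sprod X (simplex 1)) Z,
    (forall n (x : X n), h n (x, vertex1 ord0 n) = f n x) /\
    (forall n (x : X n), h n (x, vertex1 ord_max n) = g n x).

(** [f] and [g] lie in the same class in [pi_0 (Fun(X, Z))]. *)
Definition shomotopic (X Z : sset) : smor X Z -> smor X Z -> Prop :=
  clos_refl_sym_trans _ (@shomotopy1 X Z).

(** Weak homotopy equivalences of simplicial sets, defined by the requirement
    that [pi_0 (Fun(Y, Z)) -> pi_0 (Fun(X, Z))] is bijective for every Kan
    complex [Z] (as in Gabriel-Zisman, Joyal, and Lurie's Kerodon). *)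
Definition weak_homotopy_equivalence (X Y : sset) (f : smor X Y) : Prop :=
  forall Z : sset, kan Z ->
    (forall g g' : smor Y Z,
       shomotopic (scomp g f) (scomp g' f) -> shomotopic g g') /\
    (forall h : smor X Z, exists g : smor Y Z, shomotopic (scomp g f) h).

Definition ord_cat (n : nat) : category.
Proof.
exists 'I_n.+1 (fun i j => is_true (i <= j)) (fun i => leqnn i)
  (fun i j k (g : j <= k) (f : i <= j) => leq_trans f g).
all: by move=> *; exact: bool_irrelevance.
Defined.

Definition ord_functor m n (a : monotone m n) : functor (ord_cat m) (ord_cat n).
Proof.
exists (fun i : ord_cat m => a i : ord_cat n) (fun i j => mono_homo a (j:=j)).
all: by move=> *; exact: bool_irrelevance.
Defined.

Definition nerve (C : category) : sset.
Proof.
exists (fun n => functor (ord_cat n) C) (fun _ _ a x => compF x (ord_functor a)).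
- move=> n x; apply: functor_ext => i j f /=; apply/eqm_of_eq.
  by apply: (congr1 (fmap x)); exact: bool_irrelevance.
- move=> l m n b a x; apply: functor_ext => i j f /=; apply/eqm_of_eq.
  by apply: (congr1 (fmap x)); exact: bool_irrelevance.
Defined.

Definition nerve_map (C D : category) (F : functor C D) : smor (nerve C) (nerve D).
Proof.
exists (fun _ (x : nerve C _) => compF F x : nerve D _).
by move=> m n a x; apply: functor_ext.
Defined.

Definition weak_equivalence (C D : category) (F : functor C D) : Prop :=
  weak_homotopy_equivalence (nerve_map F).

Record injection (U V : Type) := Injection {
  inj_fun :> U -> V;
  inj_inj : injective inj_fun }.

Lemma injection_ext U V (u v : injection U V) : (forall x, u x = v x) -> u = v.
Proof.
case: u v => [u hu] [v hv] /= uv; have e : u = v by apply: funext.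
by subst v; congr Injection; exact: Prop_irrelevance.
Qed.

Definition injc U V W (v : injection V W) (u : injection U V) :
  injection U W := Injection (inj_comp (@inj_inj _ _ v) (@inj_inj _ _ u)).

Definition inj_id U : injection U U := Injection (@ssrfun.inj_id U).

Notation Inj := (injection nat nat).
Notation "1M" := (inj_id nat) (at level 0).
Notation "u *M v" := (injc (u : Inj) (v : Inj))
  (at level 40, left associativity).

Lemma mulM1 (u : Inj) : u *M 1M = u. Proof. exact: injection_ext. Qed.
Lemma mul1M (u : Inj) : 1M *M u = u. Proof. exact: injection_ext. Qed.
Lemma mulMA (u v w : Inj) : u *M (v *M w) = u *M v *M w.
Proof. exact: injection_ext. Qed.

Notation EM := (Ecat Inj).

Record Mcategory := MCategory {
  mcat :> category;
  act : functor (prod_cat EM mcat) mcat;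
  act1 : forall x : mcat, act (1M, x) = x;
  act1m : forall (x y : mcat) (f : hom x y),
    @fmap _ _ act (1M, x) (1M, y) (Emor 1M 1M, f) === f;
  actA : forall (u v : Inj) (x : mcat), act (u, act (v, x)) = act (u *M v, x);
  actAm : forall (u u' v v' : Inj) (x y : mcat) (f : hom x y),
    @fmap _ _ act (u, act (v, x)) (u', act (v', y))
      (Emor u' u, @fmap _ _ act (v, x) (v', y) (Emor v' v, f))
    === @fmap _ _ act (u *M v, x) (u' *M v', y)
          (Emor (u' *M v') (u *M v), f) }.

Arguments act {m}.

(** [(u', u) : u -> u'] acting on [f : x -> y]; target index first. *)
Definition actm (C : Mcategory) (u' u : Inj) (x y : C) (f : hom x y) :
    hom (act (u, x)) (act (u', y)) :=
  @fmap _ _ act (u, x) (u', y) (Emor u' u, f).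

(** [bracket v u x] is [[v,u]^x : u_* x -> v_* x]. *)
Definition bracket (C : Mcategory) (v u : Inj) (x : C) :
  hom (act (u, x)) (act (v, x)) := actm v u (idm x).

Section MCatTheory.
Variable C : Mcategory.

Lemma actm_comp (u u' u'' : Inj) (x y z : C) (g : hom y z) (f : hom x y) :
  actm u'' u' g \oC actm u' u f = actm u'' u (g \oC f).
Proof. by rewrite /actm -fmapM. Qed.

Lemma actm_id (u : Inj) (x : C) : actm u u (idm x) = idm (act (u, x)).
Proof. by rewrite /actm (fmap1 act (u, x)). Qed.

Lemma actm_eqm (u v u' v' : Inj) (x y x' y' : C)
    (f : hom x y) (f' : hom x' y') :
  u = u' -> v = v' -> f === f' -> actm u v f === actm u' v' f'.
Proof. by move=> -> -> ; case: _ _ _ /. Qed.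

Lemma actmA (u u' v v' : Inj) (x y : C) (f : hom x y) :
  actm u' u (actm v' v f) === actm (u' *M v') (u *M v) f.
Proof. exact: actAm. Qed.

Lemma actm1 (x y : C) (f : hom x y) : actm 1M 1M f === f.
Proof. exact: act1m. Qed.

End MCatTheory.

Definition ustar (C : Mcategory) (u : Inj) : functor C C.
Proof.
exists (fun x : C => act (u, x)) (fun x y f => actm u u f).
- by move=> x; exact: actm_id.
- by move=> x y z g f; rewrite actm_comp.
Defined.

Definition is_Mmorphism (C D : Mcategory) (F : functor C D) : Prop :=
  (forall (u : Inj) (x : C), F (act (u, x)) = act (u, F x)) /\
  (forall (v u : Inj) (x y : C) (f : hom x y),
     fmap F (actm v u f) === actm v u (fmap F f)).

Local Open Scope classical_set_scope.

Definition supported_on (C : Mcategory) (A : set nat) (x : C) : Prop :=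
  forall u : Inj, (forall i, A i -> u i = i) -> ustar C u x = x.

Definition finitely_supported (C : Mcategory) (x : C) : Prop :=
  exists A : set nat, finite_set A /\ supported_on A x.

Definition tame (C : Mcategory) : Prop := forall x : C, finitely_supported x.

Lemma perm_extends (u : Inj) (s : seq nat) : exists p q : Inj,
  p *M q = 1M /\ q *M p = 1M /\ {in s, forall i, p i = u i}.
Proof.
elim: s => [|a s [p [q [pq [qp ps]]]]].
  by exists 1M, 1M; split; [exact: mulM1|split; [exact: mulM1|]].
case: (boolP (a \in s)) => as_.
  by exists p, q; split=> //; split=> // i; rewrite inE => /predU1P[->|]; exact: ps.
pose t i := if i == p a then u a else if i == u a then p a else i.
have tK : involutive t.
  move=> i; rewrite /t; case: (eqVneq i (p a)) => [->|nip].
    by case: (eqVneq (u a) (p a)) => [->|_]; rewrite ?eqxx.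
  case: (eqVneq i (u a)) => [->|niu]; first by rewrite eqxx.
  by rewrite (negPf nip) (negPf niu).
pose T : Inj := Injection (inv_inj tK).
have TT : T *M T = 1M by apply: injection_ext.
exists (T *M p), (q *M T); split; last split.
- by rewrite -mulMA (mulMA p) pq mul1M.
- by rewrite -mulMA (mulMA T) TT mul1M.
move=> i; rewrite inE /= /t => /predU1P[->|si]; first by rewrite eqxx.
have nia : i != a by apply: contraNneq as_ => <-.
rewrite (inj_eq (@inj_inj _ _ p)) (negPf nia) ps //.
by rewrite (inj_eq (@inj_inj _ _ u)) (negPf nia).
Qed.

Lemma finsupp_eq (C : Mcategory) (s : seq nat) (x : C) (u v : Inj) :
  supported_on [set` s] x -> {in s, forall i, u i = v i} ->
  act (u, x) = act (v, x).
Proof.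
move=> sx uv; have [p [q [pq [qp ps]]]] := perm_extends u s.
have -> : act (u, x) = act (p, x).
  have -> : u = p *M (q *M u) by rewrite mulMA pq mul1M.
  rewrite -actA; congr (act (p, _)); apply: sx => i /= si; rewrite -ps //.
  by have /(congr1 (fun z : Inj => z i)) := qp.
have -> : v = p *M (q *M v) by rewrite mulMA pq mul1M.
rewrite -actA; congr (act (p, _)); apply/esym/sx => i /= si.
rewrite -uv // -ps //.
by have /(congr1 (fun z : Inj => z i)) := qp.
Qed.

Lemma finitely_supported_act (C : Mcategory) (u : Inj) (x : C) :
  finitely_supported x -> finitely_supported (ustar C u x).
Proof.
move=> [A [/finite_seqP[s ->] sx]]; exists [set` map u s]; split.
  by apply/finite_seqP; exists (map u s).
move=> v vu /=; rewrite actA; apply: (finsupp_eq sx) => i si /=.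
by apply: vu => /=; exact: map_f.
Qed.

Section Tau.
Variable C : Mcategory.

Let T := full_subcat (@finitely_supported C).

Definition tau_act : functor (prod_cat EM T) T.
Proof.
exists (fun p : prod_cat EM T =>
          exist _ (act (p.1, sval p.2)) (finitely_supported_act p.1 (svalP p.2)) : T)
       (fun p q f => actm q.1 p.1 (f.2 : @hom C (sval p.2) (sval q.2))).
- by move=> [u x] /=; exact: actm_id.
- by move=> [u x] [v y] [w z] [_ g] [_ f] /=; rewrite actm_comp.
Defined.

Definition tau : Mcategory.
Proof.
exists T tau_act.
- by move=> [x px]; apply: eq_exist; exact: act1.
- by move=> x y f; apply: full_eqm; exact: act1m.
- by move=> u v [x px]; apply: eq_exist; exact: actA.
- by move=> u u' v v' x y f; apply: full_eqm; exact: actAm.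
Defined.

Definition tau_incl : functor tau C := full_incl (@finitely_supported C).

End Tau.

Record Gcategory (gT : finGroupType) := GCategory {
  gcat :> category;
  gact : gT -> functor gcat gcat;
  gact1 : gact 1%g = idF gcat;
  gactM : forall g h, gact (g * h)%g = compF (gact g) (gact h) }.

Arguments gact {gT g0} _.

Section FixedPoints.
Variables (gT : finGroupType) (C : Gcategory gT).

Definition fixed_ob (x : C) : Prop := forall g : gT, gact g x = x.

Definition fixed_hom (x y : C) (f : hom x y) : Prop :=
  forall g : gT, fmap (gact g) f === f.

Lemma fixed_idm (x : C) : fixed_ob x -> fixed_hom (idm x).
Proof. by move=> hx g; rewrite fmap1; exact: eqm_id. Qed.

Lemma fixed_comp (x y z : C) (b : hom y z) (a : hom x y) :
  fixed_hom b -> fixed_hom a -> fixed_hom (b \oC a).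
Proof. by move=> hb ha g; rewrite fmapM; exact: eqm_comp. Qed.

(** [C^G]: the G-fixed objects and the G-fixed morphisms. *)
Definition fixed_cat : category.
Proof.
exists {x : C | fixed_ob x}
  (fun x y => {f : hom (sval x) (sval y) | fixed_hom f})
  (fun x => exist _ (idm (sval x)) (fixed_idm (svalP x)))
  (fun x y z b a => exist _ (sval b \oC sval a) (fixed_comp (svalP b) (svalP a))).
- by move=> x y [f hf]; apply: eq_exist; exact: comp1m.
- by move=> x y [f hf]; apply: eq_exist; exact: compm1.
- by move=> x y z t h g f; apply: eq_exist; exact: compA.
Defined.

Definition equivariant_functor (X : functor (Ecat gT) C) : Prop :=
  (forall g h, X (g * h)%g = gact g (X h)) /\
  (forall g k h, fmap X (Emor (g * k)%g (g * h)%g) ===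
                 fmap (gact g) (fmap X (Emor k h))).

Definition equivariant_nattrans (X Y : functor (Ecat gT) C)
    (t : nattrans X Y) : Prop :=
  forall g h, t (g * h)%g === fmap (gact g) (t h).

Lemma equivariant_idN (X : functor (Ecat gT) C) :
  equivariant_functor X -> equivariant_nattrans (idN X).
Proof. by move=> [hX _] g h /=; rewrite fmap1; apply: eqm_id. Qed.

Lemma equivariant_compN (X Y Z : functor (Ecat gT) C)
    (t : nattrans Y Z) (s : nattrans X Y) :
  equivariant_nattrans t -> equivariant_nattrans s ->
  equivariant_nattrans (compN t s).
Proof. by move=> ht hs g h /=; rewrite fmapM; apply: eqm_comp. Qed.

(** [cat^G(EG, C)], with G acting on EG by left translation. *)
Definition hfixed_cat : category.
Proof.
exists {X : functor (Ecat gT) C | equivariant_functor X}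
  (fun X Y => {t : nattrans (sval X) (sval Y) | equivariant_nattrans t})
  (fun X => exist _ (idN (sval X)) (equivariant_idN (svalP X)))
  (fun X Y Z t s => exist _ (compN (sval t) (sval s))
     (equivariant_compN (svalP t) (svalP s))).
- move=> X Y [f hf]; apply: eq_exist; apply: nattrans_ext => x; exact: comp1m.
- move=> X Y [f hf]; apply: eq_exist; apply: nattrans_ext => x; exact: compm1.
- move=> X Y Z T h g f; apply: eq_exist; apply: nattrans_ext => x; exact: compA.
Defined.

Lemma equivariant_constF (x : C) :
  fixed_ob x -> equivariant_functor (constF (Ecat gT) x).
Proof.
move=> hx; split=> [g h|g k h] /=; first by rewrite hx.
by rewrite fmap1; apply: eqm_id.
Qed.

Lemma equivariant_constN (x y : C) (f : hom x y) :
  fixed_hom f -> equivariant_nattrans (constN (Ecat gT) f).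
Proof. by move=> hf g h; apply: eqm_sym; exact: hf. Qed.

(** The comparison functor [C^G -> cat^G(EG, C)] given by constant functors. *)
Definition to_hfixed : functor fixed_cat hfixed_cat.
Proof.
exists (fun x : fixed_cat =>
          exist _ (constF _ (sval x)) (equivariant_constF (svalP x)) : hfixed_cat)
       (fun x y f => exist _ (constN (Ecat gT) (sval f)) (equivariant_constN (svalP f))).
- by move=> x; apply: eq_exist; apply: nattrans_ext.
- by move=> x y z g f; apply: eq_exist; apply: nattrans_ext.
Defined.

End FixedPoints.

Section FixedMap.
Variables (gT : finGroupType) (C D : Gcategory gT) (F : functor C D).

Definition is_Gfunctor : Prop := forall g : gT,
  compF F (gact g) = compF (gact g) F.

Lemma fixed_map_ob (FG : is_Gfunctor) (x : C) :
  fixed_ob x -> fixed_ob (F x).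
Proof.
move=> hx g; have /(congr1 (fun H : functor C D => H x)) /= := FG g.
by rewrite hx => <-.
Qed.

Lemma fixed_map_hom (FG : is_Gfunctor) (x y : C) (f : hom x y) :
  fixed_hom f -> fixed_hom (fmap F f).
Proof.
move=> hf g.
have e : fmap (compF (gact g) F) f === fmap (compF F (gact g)) f by rewrite FG.
exact: (eqm_trans e (eqm_fmap F (hf g))).
Qed.

(** The restriction [C^G -> D^G] of a G-functor. *)
Definition fixed_map (FG : is_Gfunctor) : functor (fixed_cat C) (fixed_cat D).
Proof.
exists (fun x : fixed_cat C =>
          exist _ (F (sval x)) (fixed_map_ob FG (svalP x)) : fixed_cat D)
       (fun x y f => exist _ (fmap F (sval f)) (fixed_map_hom FG (svalP f))).
- by move=> x; apply: eq_exist; exact: fmap1.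
- by move=> x y z g f; apply: eq_exist; exact: fmapM.
Defined.

End FixedMap.

Local Open Scope card_scope.

Record enumeration (U : Type) := Enumeration {
  enum_fun :> nat -> U;
  enum_inv : U -> nat;
  enum_funK : cancel enum_fun enum_inv;
  enum_invK : cancel enum_inv enum_fun }.

(** A choice of bijections [kappa_U : omega -> U], one for every countably
    infinite set [U], with [kappa_omega] the identity. *)
Record kappa_system := KappaSystem {
  kappa :> forall U : Type, [set: U] #= [set: nat] -> enumeration U;
  kappa_nat : forall (h : [set: nat] #= [set: nat]) n, kappa h n = n }.

(** [kappa_V^-1 j kappa_U], for an injection [j : U -> V]. *)
Definition reindex (K : kappa_system) (U V : Type)
    (hU : [set: U] #= [set: nat]) (hV : [set: V] #= [set: nat])
    (j : injection U V) : Inj :=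
  injc (Injection (can_inj (enum_invK (K V hV))))
    (injc j (Injection (can_inj (enum_funK (K U hU))))).

(** [j_* : C[U] -> C[V]], where the underlying categories of [C[U]] and [C[V]]
    are that of [C]. *)
Definition jstar (K : kappa_system) (C : Mcategory) (U V : Type)
    (hU : [set: U] #= [set: nat]) (hV : [set: V] #= [set: nat])
    (j : injection U V) : functor C C :=
  ustar C (reindex K hU hV j).

Record Gset (gT : finGroupType) := GSet {
  gset :> Type;
  gop : gT -> gset -> gset;
  gop1 : forall x, gop 1%g x = x;
  gopM : forall g h x, gop (g * h)%g x = gop g (gop h x) }.

Arguments gop {gT g0} _ _.

Lemma gop_inj (gT : finGroupType) (U : Gset gT) (g : gT) :
  injective (@gop gT U g).
Proof.
move=> x y /(congr1 (gop g^-1%g)).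
by rewrite -!gopM mulVg !gop1.
Qed.

Definition gop_injection (gT : finGroupType) (U : Gset gT) (g : gT) :
  injection U U := Injection (@gop_inj gT U g).

Definition Gevaluation (K : kappa_system) (C : Mcategory) (gT : finGroupType)
  (U : Gset gT) (hU : [set: U] #= [set: nat]) : Gcategory gT.
Proof.
exists C (fun g => jstar K C hU hU (gop_injection U g)).
- have e : reindex K hU hU (gop_injection U 1%g) = 1M.
    by apply: injection_ext => i /=; rewrite gop1 enum_funK.
  by apply: functor_ext => x y f /=; rewrite e; exact: actm1.
- move=> g h.
  have e : reindex K hU hU (gop_injection U (g * h)%g) =
      reindex K hU hU (gop_injection U g) *M reindex K hU hU (gop_injection U h).
    by apply: injection_ext => i /=; rewrite enum_invK gopM.
  apply: functor_ext => x y f /=; rewrite e; apply: eqm_sym; exact: actmA.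
Defined.

Definition omegaG (gT : finGroupType) : Gset gT.
Proof.
exists {ffun gT -> nat} (fun g (f : {ffun gT -> nat}) => [ffun h => f (g^-1 * h)%g]).
- by move=> f; apply/ffunP => h; rewrite ffunE invg1 mul1g.
- by move=> g k f; apply/ffunP => h; rewrite !ffunE invMg mulgA.
Defined.

Lemma omegaG_countable (gT : finGroupType) : [set: omegaG gT] #= [set: nat].
Proof.
apply: eq_card_nat; first exact: (@countableP {ffun gT -> nat}).
move=> /(finite_image (fun f : {ffun gT -> nat} => f 1%g)) fin.
apply: infinite_nat; apply: sub_finite_set fin => n _ /=.
by exists [ffun=> n]; rewrite ?ffunE.
Qed.

Definition eval_omegaG (K : kappa_system) (C : Mcategory) (gT : finGroupType) :
  Gcategory gT := Gevaluation K C (omegaG_countable gT).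

Definition FG (K : kappa_system) (gT : finGroupType) (C : Mcategory) : category :=
  fixed_cat (eval_omegaG K C gT).

Definition FhG (K : kappa_system) (gT : finGroupType) (C : Mcategory) : category :=
  hfixed_cat (eval_omegaG K C gT).

Definition FG_to_FhG (K : kappa_system) (gT : finGroupType) (C : Mcategory) :
  functor (FG K gT C) (FhG K gT C) := to_hfixed (eval_omegaG K C gT).

Definition saturated (K : kappa_system) (C : Mcategory) : Prop :=
  forall gT : finGroupType, is_equivalence (FG_to_FhG K gT C).

Lemma Mmorphism_Gfunctor (K : kappa_system) (gT : finGroupType)
    (C D : Mcategory) (F : functor C D) : is_Mmorphism F ->
  @is_Gfunctor gT (eval_omegaG K C gT) (eval_omegaG K D gT) F.
Proof. by move=> [_ hF] g; apply: functor_ext => x y f; exact: hF. Qed.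

Definition FG_map (K : kappa_system) (gT : finGroupType) (C D : Mcategory)
    (F : functor C D) (hF : is_Mmorphism F) : functor (FG K gT C) (FG K gT D) :=
  fixed_map (Mmorphism_Gfunctor K (gT:=gT) hF).

(** A global equivalence is in particular a morphism of M-categories. *)
Definition global_equivalence (K : kappa_system) (C D : Mcategory)
    (F : functor C D) : Prop :=
  exists hF : is_Mmorphism F,
    forall gT : finGroupType, weak_equivalence (FG_map K gT hF).

Section CatM.
Variable C : Mcategory.

Lemma EM_eqm (X : functor EM C) (w v w' v' : Inj) :
  w = w' -> v = v' -> fmap X (Emor w v) === fmap X (Emor w' v').
Proof. by move=> -> ->. Qed.

Lemma EM_comp (X : functor EM C) (u v w : Inj) :
  fmap X (Emor w v) \oC fmap X (Emor v u) = fmap X (Emor w u).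
Proof. by rewrite -fmapM. Qed.

Lemma EM_id (X : functor EM C) (w : Inj) : fmap X (Emor w w) = idm (X w).
Proof. exact: (fmap1 X). Qed.

(** Right translation on [M] combined with the action on [C]:
    [u_*(X)(w) = u_*(X(wu))], [u_*(X)(w,v) = u_*(X(wu,vu))]. *)
Definition catM_ob (u : Inj) (X : functor EM C) : functor EM C.
Proof.
exists (fun w : EM => ustar C u (X (w *M u)))
       (fun v w _ => fmap (ustar C u) (fmap X (Emor (w *M u) (v *M u)))).
- by move=> w; rewrite EM_id fmap1.
- by move=> v w z _ _; rewrite -fmapM EM_comp.
Defined.

Definition catM_map (u : Inj) (X Y : functor EM C) (Psi : nattrans X Y) :
  nattrans (catM_ob u X) (catM_ob u Y).
Proof.
exists (fun w : EM => fmap (ustar C u) (Psi (w *M u))).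
by move=> v w f; rewrite /= !actm_comp ntN.
Defined.

Definition catM_bracket (u' u : Inj) (X : functor EM C) :
  nattrans (catM_ob u X) (catM_ob u' X).
Proof.
exists (fun w : EM =>
  fmap (ustar C u') (fmap X (Emor (w *M u') (w *M u))) \oC bracket u' u (X (w *M u))).
by move=> v w f /=; rewrite /bracket !actm_comp !compm1 ?comp1m !EM_comp.
Defined.

Lemma catM_actE (u' u : Inj) (X Y : functor EM C) (Psi : nattrans X Y) w :
  compN (catM_bracket u' u Y) (catM_map u Psi) w =
  actm u' u (Psi (w *M u') \oC fmap X (Emor (w *M u') (w *M u))).
Proof. by rewrite /= /bracket !actm_comp compm1 ntN. Qed.

(** [(u', u) : u -> u'] and [Psi] act by [[u',u]^Y o u_*(Psi)]. *)
Definition catM_act : functor (prod_cat EM (functor_cat EM C)) (functor_cat EM C).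
Proof.
exists (fun p : prod_cat EM (functor_cat EM C) =>
          catM_ob p.1 p.2 : functor_cat EM C)
       (fun p q f => compN (catM_bracket q.1 p.1 q.2) (catM_map p.1 f.2)).
- move=> [u X]; apply: nattrans_ext => w; rewrite catM_actE /= comp1m EM_id.
  exact: actm_id.
- move=> [u X] [v Y] [z Z] [a g] [b f]; apply: nattrans_ext => w.
  rewrite catM_actE; set L := LHS.
  change (L = compN (catM_bracket z v Z) (catM_map v g) w \oC
              compN (catM_bracket v u Y) (catM_map u f) w).
  rewrite !catM_actE actm_comp {}/L; congr (actm z u _) => /=.
  rewrite -!compA; congr (_ \oC _).
  by rewrite (compA (fmap Y _)) -ntN -compA EM_comp.
Defined.

Lemma catM_ob1 (X : functor EM C) : catM_ob 1M X = X.
Proof.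
apply: functor_ext => v w [] /=; apply: eqm_trans (actm1 _) _.
by apply: EM_eqm; exact: mulM1.
Qed.

Lemma catM_obA (u v : Inj) (X : functor EM C) :
  catM_ob u (catM_ob v X) = catM_ob (u *M v) X.
Proof.
apply: functor_ext => w z [] /=; apply: eqm_trans (actmA _ _ _ _ _) _.
by apply: actm_eqm => //; apply: EM_eqm; rewrite mulMA.
Qed.

Lemma nt_eqm (X Y : functor EM C) (Psi : nattrans X Y) (w w' : Inj) :
  w = w' -> Psi w === Psi w'.
Proof. by move=> ->. Qed.

Definition catM : Mcategory.
Proof.
exists (functor_cat EM C) catM_act.
- exact: catM_ob1.
- move=> X Y Psi; apply: nattrans_eqm; [exact: catM_ob1|exact: catM_ob1|move=> w].
  rewrite catM_actE EM_id compm1; apply: eqm_trans (actm1 _) _.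
  by apply: nt_eqm; exact: mulM1.
- exact: catM_obA.
- move=> u u' v v' X Y Psi.
  apply: nattrans_eqm; [exact: catM_obA|exact: catM_obA|move=> w].
  rewrite !catM_actE actm_comp -compA EM_comp.
  apply: eqm_trans (actmA _ _ _ _ _) _; apply: actm_eqm => //.
  by apply: eqm_comp; [apply: nt_eqm|apply: EM_eqm]; rewrite mulMA.
Defined.

Definition sfunctor : functor C catM.
Proof.
exists (fun x : C => constF EM x : catM) (fun x y f => constN EM f).
- by move=> x; apply: nattrans_ext.
- by move=> x y z g f; apply: nattrans_ext.
Defined.

Definition Csat : Mcategory := tau catM.

Definition Csat_incl : functor Csat catM := @tau_incl catM.

Definition sfunctor_sat
    (Hs : forall x : C, @finitely_supported catM (sfunctor x)) : functor C Csat :=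
  full_corestrict Hs.

End CatM.

(* Main.v *)
(** Let [rho : G -> M] be the action of [G] on [omega^G], transported to [omega].
    Let [mark g] be the element of [omega] that corresponds to [g . delta_1].
    Sending [w] to the [g] at which [w (mark g)] is least is a map [phi : M -> G]
    with [g phi(w rho(g)) = phi(w)], and [phi w] depends only on the values of
    [w] at finitely many points.

    All required equivalences are equivalences of categories, hence weak
    equivalences, because natural transformations induce homotopies of nerves.
    - Saturation of [cat(M, C)]: [Y : EG -> cat(M, C)] is isomorphic to the
      constant functor at the fixed object [X(w) = Y(phi w)(w)].
    - A fixed object [X] is isomorphic to [X'(w) = X(rho (phi w)^-1)]. If [C]
      is tame, then [X'] is finitely supported: it has finitely many values,
      and an injection fixing a support of two objects fixes every morphism
      between them.
    - If [C] is saturated and [X] is fixed, then [g |-> X(rho g^-1)] is an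
      object of [cat^G(EG, C)], hence is isomorphic to a constant functor at a
      fixed [x], and the isomorphism extends along [X] to [s(x) -> X]. *)

From mathcomp Require Import all_boot all_fingroup.
From mathcomp Require Import boolp classical_sets functions cardinality.
From Stdlib Require Import Relation_Operators.
Require Import Defs.

Set Implicit Arguments.
Unset Strict Implicit.
Unset Printing Implicit Defensive.

(** * Isomorphisms and equivalences of categories *)

Lemma eqm_inv (C : category) (x y x' y' : C) (f : hom x y) (f' : hom x' y')
    (g : hom y x) (g' : hom y' x') :
  f === f' -> g \oC f = idm x -> f' \oC g' = idm y' -> g === g'.
Proof.
move=> ff; case: _ _ _ / ff g' => g' gf fg'; apply: eqm_of_eq.
by rewrite -(compm1 g) -fg' compA gf comp1m.
Qed.

Lemma is_iso_comp (C : category) (x y z : C) (g : hom y z) (f : hom x y) :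
  is_iso g -> is_iso f -> is_iso (g \oC f).
Proof.
move=> [g' [g'g gg']] [f' [f'f ff']]; exists (f' \oC g'); split.
  by rewrite -compA (compA g') g'g comp1m.
by rewrite -compA (compA f) ff' comp1m.
Qed.

Lemma is_iso_fmap (C D : category) (F : functor C D) (x y : C) (f : hom x y) :
  is_iso f -> is_iso (fmap F f).
Proof.
by move=> [g [gf fg]]; exists (fmap F g); rewrite -!fmapM gf fg !fmap1.
Qed.

Lemma nattrans_iso (C D : category) (X Y : functor_cat C D) (t : hom X Y) :
  (forall w, is_iso (ntc t w)) -> is_iso t.
Proof.
move=> ti; pose s w := sval (cid (ti w)).
have st w : s w \oC ntc t w = idm (fob X w) by case: (svalP (cid (ti w))).
have ts w : ntc t w \oC s w = idm (fob Y w) by case: (svalP (cid (ti w))).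
have sN w v (k : hom w v) : s v \oC fmap Y k = fmap X k \oC s w.
  rewrite -[LHS]compm1 -(ts w) -compA (compA (fmap Y k)) -ntN.
  by rewrite -!compA (compA (s v)) st comp1m.
exists (NatTrans sN : @hom (functor_cat C D) Y X).
by split; apply: nattrans_ext.
Qed.

Definition full (C D : category) (F : functor C D) : Prop :=
  forall x y (g : hom (F x) (F y)), exists f : hom x y, fmap F f = g.

Definition faithful (C D : category) (F : functor C D) : Prop :=
  forall (x y : C) (f g : hom x y), fmap F f = fmap F g -> f = g.

Definition ess_surj (C D : category) (F : functor C D) : Prop :=
  forall d : D, exists (c : C) (f : hom (F c) d), is_iso f.

(** [===] includes equality of the end points, which [F] need not reflect; hence these equalities
    are hypotheses. *)
Lemma faithful_eqm (C D : category) (F : functor C D) (x y x' y' : C)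
    (f : hom x y) (f' : hom x' y') :
  faithful F -> x = x' -> y = y' -> fmap F f === fmap F f' -> f === f'.
Proof.
by move=> Ff ex ey; subst x' y' => e; apply/eqm_of_eq/Ff/eqm_eq.
Qed.

Lemma is_equivalence_ff (C D : category) (F : functor C D) :
  full F -> faithful F -> ess_surj F -> is_equivalence F.
Proof.
move=> Ffull Ffaith Fess.
have lift x y (g : hom (F x) (F y)) : {f : hom x y | fmap F f = g}.
  exact/cid/Ffull.
have pick d : {c : C & {f : hom (F c) d &
    {g : hom d (F c) | g \oC f = idm (F c) /\ f \oC g = idm d}}}.
  have /cid[c /cid[f /cid fi]] := Fess d.
  by exists c, f.
pose c d := projT1 (pick d).
pose f d : hom (F (c d)) d := projT1 (projT2 (pick d)).
pose g d : hom d (F (c d)) := sval (projT2 (projT2 (pick d))).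
have gf d : g d \oC f d = idm (F (c d)).
  by case: (svalP (projT2 (projT2 (pick d)))).
have fg d : f d \oC g d = idm d.
  by case: (svalP (projT2 (projT2 (pick d)))).
pose Gm d d' (h : hom d d') := sval (lift (c d) (c d') (g d' \oC h \oC f d)).
have G1 d : Gm d d (idm d) = idm (c d).
  by apply: Ffaith; rewrite (svalP (lift _ _ _)) compm1 gf fmap1.
have GM d1 d2 d3 (k : hom d2 d3) (h : hom d1 d2) :
    Gm d1 d3 (k \oC h) = Gm d2 d3 k \oC Gm d1 d2 h.
  apply: Ffaith; rewrite fmapM !(svalP (lift _ _ _)).
  by rewrite !compA -(compA _ (f d2)) fg compm1.
pose G : functor D C := Functor G1 GM.
exists G; split.
  unshelve eexists.
    exists (fun x : C => sval (lift x (c (F x)) (g (F x)))).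
    move=> x y h; apply: Ffaith; rewrite !fmapM !(svalP (lift _ _ _)).
    by rewrite -!compA fg compm1.
  move=> x /=; exists (sval (lift (c (F x)) x (f (F x)))).
  by split; apply: Ffaith; rewrite fmapM fmap1 !(svalP (lift _ _ _)) ?gf ?fg.
unshelve eexists.
  exists f => d d' h /=.
  by rewrite (svalP (lift _ _ _)) !compA fg comp1m.
by move=> d; exists (g d); split; [exact: gf|exact: fg].
Qed.

(** * Natural transformations as homotopies of nerves *)

Lemma shomotopic_trans (X Z : sset) (f g h : smor X Z) :
  shomotopic f g -> shomotopic g h -> shomotopic f h.
Proof. exact: rst_trans. Qed.

Lemma shomotopic_sym (X Z : sset) (f g : smor X Z) :
  shomotopic f g -> shomotopic g f.
Proof. exact: rst_sym. Qed.

Lemma smor_ext (X Y : sset) (f g : smor X Y) :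
  (forall n x, f n x = g n x) -> f = g.
Proof.
case: f g => [f fN] [g gN] /= fg.
have e : f = g by apply: functional_extensionality_dep => n; apply: funext.
by subst g; congr SMor; exact: Prop_irrelevance.
Qed.

Lemma shomotopic_precomp (X Y Z : sset) (f : smor X Y) (g g' : smor Y Z) :
  shomotopic g g' -> shomotopic (scomp g f) (scomp g' f).
Proof.
elim=> [a b [h [h0 h1]]|a|a b _|a b c _ ab _]; last 3 first.
- exact: rst_refl.
- exact: shomotopic_sym.
- exact: shomotopic_trans.
apply: rst_step; unshelve eexists.
  exists (fun n (p : sprod X (simplex 1) n) =>
    h n ((f n p.1, p.2) : sprod Y (simplex 1) n)).
  by move=> m n s p /=; rewrite sfunN -(sfunN h).
by split=> n x /=.
Qed.

Lemma shomotopic_postcomp (X Y Z : sset) (f f' : smor X Y) (g : smor Y Z) :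
  shomotopic f f' -> shomotopic (scomp g f) (scomp g f').
Proof.
elim=> [a b [h [h0 h1]]|a|a b _|a b c _ ab _]; last 3 first.
- exact: rst_refl.
- exact: shomotopic_sym.
- exact: shomotopic_trans.
apply: rst_step; exists (scomp g h).
by split=> n x /=; rewrite ?h0 ?h1.
Qed.

Section NaturalHomotopy.
Variables (C D : category) (F G : functor C D) (t : nattrans F G).

(** Together with [cylinder_map] this is the functor from [C x [1]] to [D] encoding [t]; the ordinal
    [[1]] is [bool], ordered by implication. *)
Definition cylinder_ob (c : C) (b : bool) : D := if b then G c else F c.

Definition cylinder_map (c c' : C) (b b' : bool) (f : hom c c') :
  b ==> b' -> hom (cylinder_ob c b) (cylinder_ob c' b').
Proof.
case: b b' => [] [] // _.
- exact: (fmap G f).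
- exact: (t c' \oC fmap F f).
- exact: (fmap F f).
Defined.

Lemma cylinder_map1 (c : C) (b : bool) (bb : b ==> b) :
  cylinder_map (idm c) bb = idm (cylinder_ob c b).
Proof. by case: b bb => bb /=; rewrite fmap1. Qed.

Lemma cylinder_mapM (c c' c'' : C) (b b' b'' : bool) (g : hom c' c'')
    (f : hom c c') (p : b' ==> b'') (q : b ==> b') (r : b ==> b'') :
  cylinder_map (g \oC f) r = cylinder_map g p \oC cylinder_map f q.
Proof.
case: b b' b'' p q r => [] [] [] //= _ _ _; rewrite fmapM //.
  by rewrite !compA ntN.
by rewrite compA.
Qed.

Lemma simplex1_imply n (s : monotone n 1) (i j : 'I_n.+1) :
  i <= j -> (s i != 0 :> nat) ==> (s j != 0 :> nat).
Proof.
move=> /(mono_homo s) le_s; apply/implyP; rewrite -!lt0n => /leq_trans; exact.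
Qed.

Definition cylinder_simplex n (x : nerve C n) (s : simplex 1 n) : nerve D n.
Proof.
exists (fun i : ord_cat n => cylinder_ob (fob x i) (s i != 0 :> nat))
  (fun (i j : ord_cat n) (ij : hom i j) =>
     cylinder_map (fmap x ij) (simplex1_imply s ij)).
- by move=> i; rewrite fmap1 cylinder_map1.
- by move=> i j k g f; rewrite fmapM; exact: cylinder_mapM.
Defined.

Lemma cylinder_simplexN m n (a : monotone m n) (x : nerve C n) (s : simplex 1 n) :
  cylinder_simplex (smap a x) (smap a s) = smap a (cylinder_simplex x s).
Proof.
apply: functor_ext => i j f /=; apply/eqm_of_eq; congr cylinder_map.
exact: bool_irrelevance.
Qed.

Lemma nerve_homotopy : shomotopic (nerve_map F) (nerve_map G).
Proof.
apply: rst_step; unshelve eexists.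
  exists (fun n (p : sprod (nerve C) (simplex 1) n) =>
    cylinder_simplex p.1 p.2).
  by move=> m n a [x s]; exact: cylinder_simplexN.
by split=> n x; apply: functor_ext => i j f.
Qed.

End NaturalHomotopy.

Lemma nerve_mapM (C D E : category) (G : functor D E) (F : functor C D) :
  nerve_map (compF G F) = scomp (nerve_map G) (nerve_map F).
Proof. by apply: smor_ext => n x; apply: functor_ext. Qed.

Lemma scompA (X Y Z W : sset) (h : smor Z W) (g : smor Y Z) (f : smor X Y) :
  scomp h (scomp g f) = scomp (scomp h g) f.
Proof. exact: smor_ext. Qed.

Lemma scomp_id (C : category) (Z : sset) (g : smor (nerve C) Z) :
  scomp g (nerve_map (idF C)) = g.
Proof. by apply: smor_ext => n x /=; congr (g n _); apply: functor_ext. Qed.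

(** Precomposition with the nerve of the quasi-inverse inverts precomposition with the nerve of [F]
    up to homotopy; [t] gives injectivity and [s] gives surjectivity. *)
Lemma weak_equivalence_of_equivalence (C D : category) (F : functor C D) :
  is_equivalence F -> weak_equivalence F.
Proof.
move=> [G [[s _] [t _]]] Z _.
have hs := nerve_homotopy s; have ht := nerve_homotopy t.
rewrite !nerve_mapM in hs ht.
split=> [g g' /(shomotopic_precomp (nerve_map G))|h].
  rewrite -!scompA => gg'.
  rewrite -(scomp_id g) -(scomp_id g').
  apply: shomotopic_trans (shomotopic_postcomp g' ht).
  apply: shomotopic_trans gg'.
  exact/shomotopic_sym/shomotopic_postcomp.
exists (scomp h (nerve_map G)); rewrite -scompA -[X in shomotopic _ X]scomp_id.
exact/shomotopic_sym/shomotopic_postcomp.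
Qed.

(** * Fixed points and homotopy fixed points *)

Section FixedPointsTheory.
Variables (gT : finGroupType).

(** Each [g] carries the inverse to an inverse of the same morphism, so uniqueness of inverses makes
    it fixed. *)
Lemma fixed_iso (C : Gcategory gT) (x y : fixed_cat C) (f : hom x y) :
  is_iso (sval f) -> is_iso f.
Proof.
case: f => f hf [g [gf fg]].
have hg : fixed_hom g.
  move=> k; apply: (eqm_inv (hf k)) fg.
  by rewrite -fmapM gf fmap1.
by exists (exist _ g hg); split; apply: eq_exist.
Qed.

Lemma hfixed_iso (C : Gcategory gT) (X Y : hfixed_cat C) (s : hom X Y) :
  (forall g, is_iso (sval s g)) -> is_iso s.
Proof.
case: X Y s => [X hX] [Y hY] [s hs] /= si.
have [t [ts st]] := @nattrans_iso _ _ X Y s si.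
have tsE g : ntc t g \oC s g = idm (X g) := congr1 (fun r => ntc r g) ts.
have stE g : s g \oC ntc t g = idm (Y g) := congr1 (fun r => ntc r g) st.
have ht : equivariant_nattrans t.
  move=> g h; apply: (eqm_inv (hs g h)); first exact: tsE.
  by rewrite -fmapM stE fmap1.
by exists (exist _ t ht); split; apply: eq_exist.
Qed.

(** Faithfulness makes the preimage of a fixed morphism fixed, so fullness passes to fixed points;
    only essential surjectivity is a genuine condition there. *)
Lemma fixed_map_equivalence (C D : Gcategory gT) (F : functor C D)
    (FG : is_Gfunctor F) :
  full F -> faithful F ->
  (forall d : D, fixed_ob d -> exists (c : C) (f : hom (F c) d),
     [/\ fixed_ob c, fixed_hom f & is_iso f]) ->
  is_equivalence (fixed_map FG).
Proof.
move=> Ffull Ffaith Fess; apply: is_equivalence_ff.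
- move=> [x hx] [y hy] [g hg] /=; have [f fg] := Ffull _ _ g.
  have hf : fixed_hom f.
    move=> k; apply: (faithful_eqm Ffaith); [exact: hx|exact: hy|].
    have e : fmap (compF F (gact k)) f === fmap (compF (gact k) F) f.
      by rewrite FG.
    by apply: eqm_trans e _; rewrite /= fg; exact: hg.
  by exists (exist _ f hf); apply: eq_exist.
- move=> x y [f hf] [g hg] /(congr1 sval) /= e.
  by apply: eq_exist; exact: Ffaith.
- move=> [d hd]; have [c [f [hc hf fi]]] := Fess d hd.
  by exists (exist _ c hc), (exist _ f hf); exact: fixed_iso.
Qed.

(** An equivariant transformation from a constant functor is determined by its
    component at [1]; [fixed_model f] is the condition on that component. *)
Definition fixed_model (C : Gcategory gT) (Y : functor (Ecat gT) C) (x : C)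
    (f : hom x (Y 1%g)) : Prop :=
  [/\ fixed_ob x, is_iso f &
   forall g : gT, fmap Y (Emor g 1%g) \oC f === fmap (gact g) f].

Lemma fixed_model_comp (C : Gcategory gT) (Y : functor (Ecat gT) C) (x x' : C)
    (f : hom x (Y 1%g)) (e : hom x' x) :
  fixed_model f -> fixed_ob x' -> is_iso e -> fixed_hom e ->
  fixed_model (f \oC e).
Proof.
move=> [hx fi hf] hx' ei he; split=> //; first exact: is_iso_comp.
move=> g; rewrite compA fmapM; apply: eqm_comp; first exact: hf.
exact/eqm_sym/he.
Qed.

Lemma to_hfixed_equivalence (C : Gcategory gT) :
  is_equivalence (to_hfixed C) <->
  forall Y : functor (Ecat gT) C, equivariant_functor Y ->
    exists (x : C) (f : hom x (Y 1%g)), fixed_model f.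
Proof.
split=> [[G [_ [t ti]]] Y hY|ess].
  have [t' [t't tt']] := ti (exist _ Y hY).
  set x := G (exist _ Y hY) in t' t't tt'.
  exists (sval x), (sval (t (exist _ Y hY)) 1%g); split.
  - exact: svalP.
  - exists (sval t' 1%g); split.
      exact: (congr1 (fun s : @hom (hfixed_cat C) _ _ => ntc (sval s) 1%g) t't).
    exact: (congr1 (fun s : @hom (hfixed_cat C) _ _ => ntc (sval s) 1%g) tt').
  - move=> g; rewrite -(ntN (sval (t (exist _ Y hY))) (Emor g 1%g)) /= compm1.
    by have := svalP (t (exist _ Y hY)) g 1%g; rewrite mulg1.
apply: is_equivalence_ff.
- move=> [x hx] [y hy] [s hs] /=.
  have sE g : s g = s 1%g.
    by have := ntN s (Emor g 1%g); rewrite /= compm1 comp1m.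
  have hf : fixed_hom (s 1%g : hom x y).
    by move=> g; have := hs g 1%g; rewrite mulg1 sE => /eqm_sym.
  exists (exist _ (s 1%g : hom x y) hf).
  apply: eq_exist; apply: nattrans_ext => g.
  by rewrite /= (sE g).
- move=> x y [f hf] [g hg] e; apply: eq_exist.
  exact: (congr1 (fun s : @hom (hfixed_cat C) _ _ => ntc (sval s) 1%g) e).
- move=> [Y hY]; have [x [f [hx [f' [f'f ff']] hf]]] := ess Y hY.
  have sN g h (k : @hom (Ecat gT) g h) : fmap Y (Emor h 1%g) \oC f \oC idm x =
      fmap Y k \oC (fmap Y (Emor g 1%g) \oC f).
    by rewrite compm1 compA -fmapM.
  pose s := @NatTrans _ _ (constF (Ecat gT) x) Y
    (fun g => fmap Y (Emor g 1%g) \oC f) sN.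
  have hs : equivariant_nattrans s.
    move=> g h /=.
    (* Factoring through [g] lets equivariance of [Y] treat the first factor and the condition on
       [f] the second. *)
    have -> : fmap Y (Emor (g * h)%g 1%g) =
        fmap Y (Emor (g * h)%g g) \oC fmap Y (Emor g 1%g) by rewrite -fmapM.
    rewrite fmapM -compA.
    have := hY.2 g h 1%g; rewrite mulg1 => YE.
    exact: eqm_comp YE (hf g).
  exists (exist _ x hx), (exist _ s hs); apply: hfixed_iso => g /=.
  apply: is_iso_comp; last by exists f'.
  by exists (fmap Y (Emor 1%g g)); split; rewrite -fmapM -fmap1.
Qed.

End FixedPointsTheory.

(** * Supports of objects and of morphisms *)

Section Support.
Variable C : Mcategory.

Lemma supported_onS (A B : set nat) (x : C) :
  (forall i, A i -> B i) -> supported_on A x -> supported_on B x.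
Proof. by move=> AB sx u uB; apply: sx => i /AB; exact: uB. Qed.

Lemma finitely_supportedP (x : C) :
  finitely_supported x <-> exists n, supported_on `I_n x.
Proof.
split=> [[A [/finite_seqP[s ->] sx]]|[n sx]]; last first.
  by exists `I_n; split=> //; exact: finite_II.
exists (\max_(i <- s) i).+1; apply: supported_onS sx => i /= si.
by rewrite ltnS; exact: leq_bigmax_seq.
Qed.

(** Composing [w_* f] with the brackets between [1M] and [w] on both sides recovers [f]. *)
Lemma ustar_faithful (w : Inj) : faithful (ustar C w).
Proof.
move=> x y f g /= e; apply: eqm_eq.
suff fE (h : @hom C x y) :
    h === actm 1M w (idm y) \oC actm w w h \oC actm w 1M (idm x).
  by apply: eqm_trans (fE f) _; rewrite e; exact/eqm_sym/fE.
by rewrite !actm_comp comp1m compm1; exact/eqm_sym/actm1.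
Qed.

Section FixInitialSegment.
Variable n : nat.

Definition fixes (u : Inj) : Prop := forall i, i < n -> u i = i.

Lemma fixes_act (u : Inj) (x : C) :
  supported_on `I_n x -> fixes u -> act (u, x) = x.
Proof. by move=> sx un; exact: sx. Qed.

Lemma fixes_ge (u : Inj) i : fixes u -> n <= i -> n <= u i.
Proof.
move=> un; rewrite leqNgt (leqNgt n (u i)); apply: contra => ui.
have e : u i = i by apply: (@inj_inj _ _ u); exact: un.
by rewrite -e.
Qed.

(** The points from [n] on go to even ([b = false]) or odd ([b = true]) distances from [n], so the
    two images cover [omega] and meet only in the fixed segment. *)
Definition stretch_fun (b : bool) (i : nat) : nat :=
  if i < n then i else n + (b + (i - n).*2).

Lemma stretch_inj b : injective (stretch_fun b).
Proof.
move=> i j; rewrite /stretch_fun.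
case: (ltnP i n) => ni; case: (ltnP j n) => nj.
- by [].
- by move=> e; move: ni; rewrite e ltnNge leq_addr.
- by move=> e; move: nj; rewrite -e ltnNge leq_addr.
move=> /addnI/addnI/double_inj.
by rewrite -{2}(subnKC ni) -{2}(subnKC nj) => ->.
Qed.

Definition stretch (b : bool) : Inj := Injection (@stretch_inj b).

Lemma stretch_fixes b : fixes (stretch b).
Proof. by move=> i /= ni; rewrite /stretch_fun ni. Qed.

Lemma stretch_ge b i : n <= i -> stretch b i = n + (b + (i - n).*2).
Proof. by rewrite leqNgt /= /stretch_fun => /negPf ->. Qed.

Lemma fixes_comp (u v : Inj) : fixes u -> fixes v -> fixes (u *M v).
Proof. by move=> un vn i ni /=; rewrite vn // un. Qed.

Section Glue.
Variables u v : Inj.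
Hypotheses (un : fixes u) (vn : fixes v).
Hypothesis uv_disjoint : forall i j, n <= i -> n <= j -> u i <> v j.

(** An interpolation between [u] and [v]: it agrees with [u] on the image of [stretch false] and
    with [v] on that of [stretch true]. Below [n] the truncated difference is 0, and there [u] and
    [v] are both the identity. *)
Definition glue_fun (i : nat) : nat := if odd (i - n) then v i else u i.

Lemma glue_inj : injective glue_fun.
Proof.
move=> i j; rewrite /glue_fun.
case: ifPn => oi; case: ifPn => oj; try exact: inj_inj.
(* An odd [i - n] is nonzero, hence [n <= i]. If [j < n], then [u j = v j], and injectivity of [v]
   applies. *)
- have ni : n <= i by rewrite leqNgt; apply: contraL oi => /ltnW /eqP ->.
  case: (leqP n j) => nj e; first by case: (uv_disjoint nj ni).
  by move: e; rewrite (un nj) -{1}(vn nj) => /(@inj_inj _ _ v).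
- have nj : n <= j by rewrite leqNgt; apply: contraL oj => /ltnW /eqP ->.
  case: (leqP n i) => ni e; first by case: (uv_disjoint ni nj).
  by move: e; rewrite (un ni) -{1}(vn ni) => /(@inj_inj _ _ v).
Qed.

Lemma glue_stretch (b : bool) :
  Injection glue_inj *M stretch b = (if b then v else u) *M stretch b.
Proof.
apply: injection_ext => i.
rewrite -[LHS]/(glue_fun (stretch b i)).
rewrite -[RHS]/((if b then v else u) (stretch b i)).
rewrite /glue_fun; case: (ltnP i n) => ni.
  rewrite stretch_fixes // un // vn //.
  by case: ifP => _; case: b; rewrite ?un ?vn.
by rewrite stretch_ge // addKn oddD oddb odd_double addbF; case: b.
Qed.

End Glue.

Variables (x : C).
Hypothesis sx : supported_on `I_n x.

(** Since [x = w_* x], the bracket equals [[vw,uw]^x], whose two indices coincide. *)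
Lemma bracket_agree (u v w : Inj) :
  fixes w -> u *M w = v *M w -> bracket v u x === idm (act (u, x)).
Proof.
move=> wn uw; apply: (@eqm_trans _ _ _ _ _ _ _ _ (bracket v u (act (w, x)))).
  by apply: actm_eqm => //; apply/eqm_id/esym/fixes_act.
rewrite /bracket -(actm_id w).
apply: eqm_trans (actmA _ _ _ _ _) _; rewrite -uw actm_id.
by apply: eqm_id; rewrite -actA (fixes_act sx wn).
Qed.

Lemma bracket_comp (w v u : Inj) (y : C) :
  bracket w v y \oC bracket v u y = bracket w u y.
Proof. by rewrite actm_comp comp1m. Qed.

(** With [t] glued from [u] and [v], both factors of [[v,u] = [v,t] o [t,u]] are trivial by
    [bracket_agree]. *)
Lemma bracket_disjoint (u v : Inj) :
  fixes u -> fixes v -> (forall i j, n <= i -> n <= j -> u i <> v j) ->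
  bracket v u x === idm x.
Proof.
move=> un vn uv; set t := Injection (glue_inj un vn uv).
have tu : u *M stretch false = t *M stretch false by rewrite glue_stretch.
have vt : t *M stretch true = v *M stretch true by rewrite glue_stretch.
have tn : fixes t.
  move=> i ni; rewrite /t /= /glue_fun.
  by case: ifP => _; [exact (vn i ni)|exact (un i ni)].
rewrite -(bracket_comp v t u) -(comp1m (idm x)); apply: eqm_comp.
  apply: eqm_trans (bracket_agree (stretch_fixes true) vt) _.
  by apply: eqm_id; exact: fixes_act.
apply: eqm_trans (bracket_agree (stretch_fixes false) tu) _.
by apply: eqm_id; exact: fixes_act.
Qed.

(** [e_* [v,u]^x = [ev,eu]^x] is the composite of [[ev,o]^x] and [[o,eu]^x], and
    each factor is trivial because the images of [eu], [ev] are disjoint from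
    that of [o] outside the fixed segment. *)
Lemma bracket_fixes (u v : Inj) :
  fixes u -> fixes v -> bracket v u x === idm x.
Proof.
move=> un vn; pose e := stretch false; pose o := stretch true.
have dis w i j : fixes w -> n <= i -> n <= j -> (e *M w) i <> o j.
  move=> wn ni nj; rewrite -[(e *M w) i]/(e (w i)).
  rewrite !stretch_ge ?fixes_ge // => /addnI /(congr1 odd).
  by rewrite !oddD !odd_double.
have en : fixes e := @stretch_fixes false.
have on : fixes o := @stretch_fixes true.
apply: (faithful_eqm (@ustar_faithful e)); [exact: fixes_act|exact: fixes_act|].
apply: eqm_trans (actmA _ _ _ _ _) _.
apply: (@eqm_trans _ _ _ _ _ _ _ _ (idm x)).
  rewrite -/(bracket (e *M v) (e *M u) x) -(bracket_comp _ o _).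
  rewrite -(comp1m (idm x)).
  apply: eqm_comp; apply: bracket_disjoint; rewrite //; try exact: fixes_comp.
    by move=> i j ni nj /esym; exact: dis.
  by move=> i j; exact: dis.
by rewrite /= actm_id; apply/eqm_id/esym/fixes_act.
Qed.

End FixInitialSegment.

(** Naturality of [[u,1]] at [f], where both brackets are identities by [bracket_fixes]. *)
Lemma actm_fixes (n : nat) (x y : C) (f : @hom C x y) (u : Inj) :
  supported_on `I_n x -> supported_on `I_n y -> fixes n u -> actm u u f === f.
Proof.
move=> sx sy un; have n1 : fixes n 1M by [].
have fE : actm u u f \oC bracket u 1M x = bracket u 1M y \oC actm 1M 1M f.
  by rewrite !actm_comp compm1 comp1m.
have bx := bracket_fixes sx n1 un; have by_ := bracket_fixes sy n1 un.
apply: (@eqm_trans _ _ _ _ _ _ _ _ (actm u u f \oC bracket u 1M x)).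
  rewrite -{1}(compm1 (actm u u f)); apply: eqm_comp; first exact: eqm_refl.
  by apply: eqm_trans (eqm_sym bx); apply: eqm_id; exact: (fixes_act sx un).
by rewrite fE -{2}(comp1m f); apply: eqm_comp => //; exact: actm1.
Qed.

End Support.

(** * The action of [G] on [omega] and the equivariant map from [M] to [G] *)

Local Open Scope classical_set_scope.
Local Open Scope card_scope.

Lemma reindex_gop1 (K : kappa_system) (gT : finGroupType) (U : Gset gT)
    (hU : [set: U] #= [set: nat]) :
  reindex K hU hU (gop_injection U 1%g) = 1M.
Proof. by apply: injection_ext => i /=; rewrite gop1 enum_funK. Qed.

Lemma reindex_gopM (K : kappa_system) (gT : finGroupType) (U : Gset gT)
    (hU : [set: U] #= [set: nat]) (g h : gT) :
  reindex K hU hU (gop_injection U (g * h)%g) =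
  reindex K hU hU (gop_injection U g) *M reindex K hU hU (gop_injection U h).
Proof. by apply: injection_ext => i /=; rewrite enum_invK gopM. Qed.

Section Marks.
Variables (K : kappa_system) (gT : finGroupType).

Let UN := omegaG_countable gT.

Definition rho (g : gT) : Inj := reindex K UN UN (gop_injection (omegaG gT) g).

Lemma rho1 : rho 1%g = 1M. Proof. exact: reindex_gop1. Qed.

Lemma rhoM g h : rho (g * h)%g = rho g *M rho h.
Proof. exact: reindex_gopM. Qed.

(** A point with trivial stabiliser, so that its translates, and hence the marks, are distinct. *)
Definition delta1 : omegaG gT := [ffun h => h == 1%g : nat].

Definition mark (g : gT) : nat := enum_inv (K _ UN) (gop g delta1).

Lemma mark_inj : injective mark.
Proof.
move=> g h e; have {}e : gop g delta1 = gop h delta1.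
  exact: (can_inj (enum_invK (K _ UN))).
have := congr1 (fun f : omegaG gT => (f : {ffun gT -> nat}) g) e.
by rewrite !ffunE mulVg eqxx -eq_mulVg1; case: eqP => [->|].
Qed.

Lemma rho_mark g h : rho g (mark h) = mark (g * h)%g.
Proof.
rewrite -[LHS]/(enum_inv _ (gop g (K _ UN (enum_inv _ _)))) enum_invK.
by rewrite /mark gopM.
Qed.

(** This is [phi]; the minimiser is unique because [w] and [mark] are injective. *)
Definition least_mark (w : Inj) : gT := [arg min_(h < 1%g) w (mark h)]%N.

Lemma least_markE (w : Inj) (g : gT) :
  (forall h, w (mark g) <= w (mark h)) -> least_mark w = g.
Proof.
rewrite /least_mark; case: arg_minnP => // h _ hmin gmin.
apply/mark_inj/(@inj_inj _ _ w)/eqP.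
by rewrite eqn_leq hmin // gmin.
Qed.

Lemma least_mark_min (w : Inj) (h : gT) : w (mark (least_mark w)) <= w (mark h).
Proof. by rewrite /least_mark; case: arg_minnP => // g _; apply. Qed.

(** The value of [w *M rho g] at [mark h] is that of [w] at [mark (g * h)], so left multiplication
    by [g] carries the minimiser of the former to that of the latter. *)
Lemma least_mark_rho (w : Inj) (g : gT) :
  (g * least_mark (w *M rho g))%g = least_mark w.
Proof.
apply/esym/least_markE => h.
have := least_mark_min (w *M rho g) (g^-1 * h)%g.
rewrite -[X in X <= _]/(w (rho g _)) -[X in _ <= X]/(w (rho g _)).
by rewrite !rho_mark mulKVg.
Qed.

Lemma least_mark_agree (w w' : Inj) :
  (forall g, w (mark g) = w' (mark g)) -> least_mark w = least_mark w'.
Proof. by move=> ww'; apply: least_markE => h; rewrite !ww' least_mark_min. Qed.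

End Marks.

(** * The category [cat(M, C)] and the functor [s] *)

Definition Emap (X Y : Type) (f : X -> Y) : functor (Ecat X) (Ecat Y) :=
  @Functor (Ecat X) (Ecat Y) f (fun x y _ => Emor (f y) (f x))
    (fun _ => erefl) (fun _ _ _ _ _ => erefl).

Definition evalF (C D : category) (x : C) : functor (functor_cat C D) D :=
  @Functor (functor_cat C D) D (fun F => fob F x) (fun _ _ t => t x)
    (fun _ => erefl) (fun _ _ _ _ _ => erefl).

Lemma Emor_iso (X : Type) (C : category) (F : functor (Ecat X) C) (x y : X) :
  is_iso (fmap F (Emor y x)).
Proof. by exists (fmap F (Emor x y)); rewrite -!fmapM -!fmap1. Qed.

Section CatMTheory.
Variable C : Mcategory.

Lemma catM_actm (u : Inj) (X Y : catM C) (Psi : @hom (catM C) X Y) (w : Inj) :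
  ntc (actm u u Psi) w = actm u u (ntc Psi (w *M u)).
Proof.
rewrite -[LHS]/(compN (catM_bracket u u Y) (catM_map u Psi) w) catM_actE.
by rewrite EM_id compm1.
Qed.

Lemma sfunctor_Mmorphism : is_Mmorphism (sfunctor C).
Proof.
have sE u x : sfunctor C (act (u, x)) = act (u, sfunctor C x).
  apply: functor_ext => w v f /=; rewrite actm_id; exact: eqm_refl.
split=> // v u x y f; apply: nattrans_eqm; [exact: sE|exact: sE|] => w.
rewrite -[X in _ === X]/(compN (catM_bracket v u (sfunctor C y))
  (catM_map u (fmap (sfunctor C) f)) w).
by rewrite catM_actE /= compm1.
Qed.

Lemma sfunctor_full : full (sfunctor C).
Proof.
move=> x y t; exists (ntc t 1M); apply: nattrans_ext => w /=.
by have := ntN t (Emor w 1M); rewrite /= compm1 comp1m.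
Qed.

Lemma sfunctor_faithful : faithful (sfunctor C).
Proof.
move=> x y f g e.
exact: (congr1 (fun t : nattrans _ _ => @ntc EM _ _ _ t 1M) e).
Qed.

Lemma sfunctor_finitely_supported (x : C) :
  finitely_supported x -> finitely_supported (sfunctor C x).
Proof.
move=> [A [finA sx]]; exists A; split=> // u uA.
by rewrite -[LHS]sfunctor_Mmorphism.1; congr (sfunctor C _); exact: sx.
Qed.

(** Every object of [EM] is uniquely isomorphic to [1M], so [X] contracts onto its value there. *)
Lemma sfunctor_ess_surj (X : catM C) :
  exists (f : @hom (catM C) (sfunctor C (fob X 1M)) X), is_iso f.
Proof.
have fN w v (k : @hom EM w v) : fmap X (Emor v 1M) \oC idm _ =
    fmap X k \oC fmap X (Emor w 1M) by rewrite compm1 -fmapM.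
exists (@NatTrans _ _ (sfunctor C (fob X 1M)) X
  (fun w => fmap X (Emor w 1M)) fN).
by apply: nattrans_iso => w; exact: Emor_iso.
Qed.

End CatMTheory.

Lemma fmap_eqm (C D : category) (F G : functor C D) (x y : C) (f : hom x y) :
  F = G -> fmap F f === fmap G f.
Proof. by move=> ->. Qed.

(** The uncurried functor [B x A -> C] of [Y], composed with [(p, id) : A -> B x A]. *)
Definition diagF (A B C : category) (Y : functor B (functor_cat A C))
    (p : functor A B) : functor A C.
Proof.
exists (fun a => fob (fob Y (p a)) a)
  (fun a a' f => ntc (fmap Y (fmap p f)) a' \oC fmap (fob Y (p a)) f).
- by move=> a; rewrite !fmap1 /= comp1m.
- move=> a a' a'' g f; rewrite !fmapM /=.
  rewrite -!compA; congr (_ \oC _); rewrite !compA; congr (_ \oC _).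
  exact: ntN.
Defined.

(** * Fixed objects of [cat(M, C)] *)

Section FixedCatM.
Variables (K : kappa_system) (gT : finGroupType) (C : Mcategory).

Notation rho := (@rho K gT).
Notation least_mark := (@least_mark K gT).
Notation evalC := (eval_omegaG K C gT).
Notation evalM := (eval_omegaG K (catM C) gT).

Lemma fixed_catM_mor (X : catM C) (g : gT) (w v : Inj) :
  fixed_ob (X : evalM) ->
  actm (rho g) (rho g) (fmap X (Emor (w *M rho g) (v *M rho g))) ===
  fmap X (Emor w v).
Proof. by move=> /(_ g) XE; apply: (fmap_eqm (Emor w v) XE). Qed.

Lemma fixed_catM_ob (X : catM C) :
  (forall g w v,
     actm (rho g) (rho g) (fmap X (Emor (w *M rho g) (v *M rho g))) ===
     fmap X (Emor w v)) -> fixed_ob (X : evalM).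
Proof. by move=> XE g; apply: functor_ext => v w []; exact: XE. Qed.

Lemma fixed_catM_hom (X Y : catM C) (t : @hom (catM C) X Y) :
  fixed_ob (X : evalM) -> fixed_ob (Y : evalM) ->
  (forall g w, actm (rho g) (rho g) (ntc t (w *M rho g)) === ntc t w) ->
  fixed_hom (t : @hom evalM X Y).
Proof.
move=> hX hY tE g; apply: nattrans_eqm; [exact: hX|exact: hY|] => w.
by rewrite catM_actm; exact: tE.
Qed.

Lemma catM_fixed_model (Y : functor (Ecat gT) evalM) :
  equivariant_functor Y ->
  exists (X : evalM) (f : hom X (Y 1%g)), fixed_model f.
Proof.
move: Y; rewrite -/(functor (Ecat gT) (functor_cat EM C)) => Y hY.
have Yob g h : fob Y (g * h)%g = catM_ob (rho g) (fob Y h) := hY.1 g h.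
have Ymor g k h w : ntc (fmap Y (Emor (g * k)%g (g * h)%g)) w ===
    actm (rho g) (rho g) (ntc (fmap Y (Emor k h)) (w *M rho g)).
  rewrite -catM_actm; exact: (eqm_fmap (evalF _ w) (hY.2 g k h)).
have YM a b c w : ntc (fmap Y (Emor a b)) w \oC ntc (fmap Y (Emor b c)) w =
    ntc (fmap Y (Emor a c)) w.
  exact: (esym (fmapM (compF (evalF _ w) Y) (Emor a b) (Emor b c))).
pose X := diagF Y (Emap least_mark).
(* Equivariance of [Y] turns the index [least_mark (w *M rho g)] into [g] times it, which is
   [least_mark w]. *)
have hX : fixed_ob (X : evalM).
  apply: fixed_catM_ob => g w v.
  rewrite -[fmap X (Emor (w *M _) _)]/(_ \oC _) -(actm_comp _ (rho g)).
  apply: eqm_comp.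
    apply: eqm_trans (eqm_sym (Ymor _ _ _ _)) _.
    by rewrite !least_mark_rho; exact: eqm_refl.
  apply: eqm_trans (fmap_eqm (Emor w v) (esym (Yob g _))) _.
  by rewrite least_mark_rho; exact: eqm_refl.
(* At each [w], [Y] transports from the index [least_mark w] to the index [1]. *)
pose f := fun w : Inj => ntc (fmap Y (Emor 1%g (least_mark w))) w.
have fN w v (k : @hom EM w v) : f v \oC fmap X k = fmap (fob Y 1%g) k \oC f w.
  by rewrite /= compA YM ntN.
exists X, (@NatTrans EM C X (fob Y 1%g) f fN); split=> //.
- apply: nattrans_iso => w; apply: (@is_iso_fmap _ _ (evalF _ w)).
  exact: Emor_iso.
- move=> g; apply: nattrans_eqm.
  + exact: (esym (hX g)).
  + by have := Yob g 1%g; rewrite mulg1.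
  move=> w; rewrite catM_actm.
  apply: eqm_trans (Ymor _ _ _ _); rewrite least_mark_rho mulg1 -(YM _ 1%g).
  exact: eqm_refl.
Qed.

Lemma catM_tau_model (X : catM C) :
  tame C -> fixed_ob (X : evalM) ->
  exists (X' : catM C) (f : @hom (catM C) X' X),
    [/\ finitely_supported X', fixed_ob (X' : evalM), is_iso f &
     fixed_hom (f : @hom evalM X' X)].
Proof.
move=> tC hX; pose p w := rho (least_mark w)^-1%g.
(* Compatibility of [p] with right translation by [rho g] lets [X'] inherit fixedness from [X]. *)
have pg g w : p (w *M rho g) = p w *M rho g.
  rewrite /p -rhoM -(least_mark_rho K w g) invMg.
  by rewrite -mulgA mulVg mulg1.
pose X' := compF X (Emap p).
have hX' : fixed_ob (X' : evalM).
  apply: fixed_catM_ob => g w v /=; rewrite !pg.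
  exact: fixed_catM_mor.
have fN w v (k : @hom EM w v) :
    fmap X (Emor v (p v)) \oC fmap X' k = fmap X k \oC fmap X (Emor w (p w)).
  by rewrite /= -!fmapM.
exists X', (@NatTrans EM C X' X (fun w => fmap X (Emor w (p w))) fN).
split=> //.
- have [n nP] : exists n, forall g, supported_on `I_n (fob X (rho g)).
    have /choice[N NP] : forall g, exists n, supported_on `I_n (fob X (rho g)).
      by move=> g; apply/finitely_supportedP/tC.
    exists (\max_g N g) => g; apply: supported_onS (NP g) => i /= iN.
    exact: leq_trans iN (leq_bigmax _).
  apply/finitely_supportedP.
  (* Below this bound lie a common support of the finitely many values of [X'] and all marks. Fixing
     the marks gives [p (w *M u) = p w]; fixing the support makes [u] act trivially on the morphisms
     of [X']. *)
  exists (maxn n (\max_(g : gT) mark K g).+1) => u un.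
  have pu w : p (w *M u) = p w.
    rewrite /p (@least_mark_agree K gT (w *M u) w) // => g /=; rewrite un //=.
    by rewrite leq_max ltnS (leq_bigmax g) orbT.
  apply: functor_ext => v w k /=; rewrite !pu.
  apply: (@actm_fixes C n); [exact: nP|exact: nP|].
  by move=> i ni; apply: un => /=; rewrite leq_max ni.
- by apply: nattrans_iso => w; exact: Emor_iso.
- apply: fixed_catM_hom => // g w /=; rewrite pg.
  exact: fixed_catM_mor.
Qed.

Lemma sfunctor_fixed_model (X : catM C) :
  saturated K C -> fixed_ob (X : evalM) ->
  exists (x : C) (f : @hom (catM C) (sfunctor C x) X),
    [/\ fixed_ob (x : evalC), is_iso f &
     fixed_hom (f : @hom evalM (sfunctor C x) X)].
Proof.
move=> /(_ gT) /to_hfixed_equivalence satC hX.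
pose p g := rho g^-1%g.
(* This identity turns fixedness of [X] under [rho g] into equivariance of [Y]. *)
have pg g h : p (g * h)%g *M rho g = p h.
  by rewrite /p -rhoM invMg -mulgA mulVg mulg1.
pose Y : functor (Ecat gT) evalC := compF X (Emap p).
have hY : equivariant_functor Y.
  have E g k h : fmap Y (Emor (g * k)%g (g * h)%g) ===
      fmap (gact g) (fmap Y (Emor k h)).
    have := fixed_catM_mor g (p (g * k)%g) (p (g * h)%g) hX.
    by rewrite !pg; exact: eqm_sym.
  split=> // g h; have := eqm_ends (E g h h); by case.
have [x [f [hx fi hf]]] := satC Y hY.
have p1 : p 1%g = 1M by rewrite /p invg1 rho1.
have sN w v (k : @hom EM w v) :
    fmap X (Emor v (p 1%g)) \oC f \oC idm x =
    fmap X k \oC (fmap X (Emor w (p 1%g)) \oC f).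
  by rewrite compm1 compA -fmapM.
exists x, (@NatTrans EM C (sfunctor C x) X
  (fun w => fmap X (Emor w (p 1%g)) \oC f) sN).
have hsx : fixed_ob (sfunctor C x : evalM).
  by apply: fixed_map_ob (Mmorphism_Gfunctor K (sfunctor_Mmorphism C)) _ hx.
split=> //.
  apply: nattrans_iso => w; apply: is_iso_comp; [exact: Emor_iso|exact: fi].
apply: fixed_catM_hom => // g w /=.
rewrite -(actm_comp _ (rho g)).
(* The detour passes through [p g] because [p g *M rho g = p 1]: fixedness of [X] treats the first
   factor, and the condition [hf] on [f] the rest. *)
apply: (@eqm_trans _ _ _ _ _ _ _ _
  (fmap X (Emor w (p g)) \oC (fmap X (Emor (p g) (p 1%g)) \oC f))).
  apply: eqm_comp; last exact: eqm_sym (hf g).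
  have := fixed_catM_mor g w (p g) hX.
  by have := pg g 1%g; rewrite mulg1 => ->.
by rewrite compA -fmapM; exact: eqm_refl.
Qed.

End FixedCatM.

(** * Passage to full subcategories *)

Section FullSubcategory.
Variables (C : category) (P : C -> Prop).

Lemma full_incl_full : full (full_incl P).
Proof. by move=> x y g; exists g. Qed.

Lemma full_incl_faithful : faithful (full_incl P).
Proof. by []. Qed.

Lemma full_corestrict_full (B : category) (F : functor B C)
    (FP : forall x, P (F x)) :
  full F -> full (full_corestrict FP).
Proof. by move=> Ffull x y g; exact: Ffull. Qed.

Lemma full_corestrict_faithful (B : category) (F : functor B C)
    (FP : forall x, P (F x)) : faithful F -> faithful (full_corestrict FP).
Proof. by move=> Ffaith x y f g; exact: Ffaith. Qed.

End FullSubcategory.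

Lemma equivariant_functor_comp (gT : finGroupType) (C D : Gcategory gT)
    (F : functor C D) (Y : functor (Ecat gT) C) :
  is_Gfunctor F -> equivariant_functor Y -> equivariant_functor (compF F Y).
Proof.
move=> FG [Yob Ymor]; split=> [g h|g k h] /=.
  by rewrite Yob; exact: (congr1 (fun H : functor C D => fob H (Y h)) (FG g)).
apply: eqm_trans (eqm_fmap F (Ymor g k h)) _.
exact: (fmap_eqm (fmap Y (Emor k h)) (FG g)).
Qed.

(** This transfers models from [cat(M, C)] back to its full subcategory of finitely supported
    objects. *)
Lemma fixed_model_reflect (gT : finGroupType) (C D : Gcategory gT)
    (F : functor C D) (Y : functor (Ecat gT) C) (x : C) (f : hom x (Y 1%g)) :
  is_Gfunctor F -> full F -> faithful F -> equivariant_functor Y -> fixed_ob x ->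
  @fixed_model _ D (compF F Y) (F x) (fmap F f) -> fixed_model f.
Proof.
move=> FG Ffull Ffaith hY hx [_ [b [bf fb]] hf]; split=> //.
  have [a ab] := Ffull _ _ b; subst b.
  by exists a; split; apply: Ffaith; rewrite fmapM fmap1.
move=> g; apply: (faithful_eqm Ffaith); first exact: (esym (hx g)).
  by have := hY.1 g 1%g; rewrite mulg1.
rewrite fmapM; apply: eqm_trans (hf g) _.
exact/eqm_sym/(fmap_eqm f (FG g)).
Qed.

Lemma tau_incl_Mmorphism (C : Mcategory) : is_Mmorphism (tau_incl C).
Proof. by split=> [u x|v u x y f]; [exact: erefl|exact: eqm_refl]. Qed.

Lemma Csat_eqm (C : Mcategory) (x y x' y' : Csat C) (f : hom x y)
    (f' : hom x' y') :
  @eqm (catM C) (sval x) (sval y) f (sval x') (sval y') f' -> f === f'.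
Proof. exact: full_eqm. Qed.

Lemma tau_fixed_ob (K : kappa_system) (gT : finGroupType) (C : Mcategory)
    (x : tau C) :
  fixed_ob (sval x : eval_omegaG K C gT) ->
  fixed_ob (x : eval_omegaG K (tau C) gT).
Proof. by case: x => x px hx g; apply: eq_exist; exact: hx. Qed.

Lemma tau_fixed_hom (K : kappa_system) (gT : finGroupType) (C : Mcategory)
    (x y : tau C) (f : @hom C (sval x) (sval y)) :
  fixed_hom (f : @hom (eval_omegaG K C gT) (sval x) (sval y)) ->
  fixed_hom (f : @hom (eval_omegaG K (tau C) gT) x y).
Proof. by move=> hf g; apply: full_eqm; exact: hf. Qed.

(** * Saturation and global equivalences *)

Section Saturation.
Variables (K : kappa_system) (C : Mcategory).

Lemma catM_saturated : saturated K (catM C).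
Proof. by move=> gT; apply/to_hfixed_equivalence; exact: catM_fixed_model. Qed.

Hypothesis tC : tame C.

Lemma Csat_incl_global_equivalence : global_equivalence K (Csat_incl C).
Proof.
exists (tau_incl_Mmorphism (catM C)) => gT.
apply: weak_equivalence_of_equivalence.
apply: fixed_map_equivalence.
- exact: full_incl_full.
- exact: full_incl_faithful.
move=> X hX; have [X' [f [tX' hX' fi hf]]] := catM_tau_model tC hX.
exists (exist _ X' tX' : Csat C), f; split=> //.
exact: tau_fixed_ob.
Qed.

(** A model found in [cat(M, C)] is replaced by an isomorphic finitely supported one and then
    reflected along the inclusion. *)
Lemma Csat_saturated : saturated K (Csat C).
Proof.
move=> gT; apply/to_hfixed_equivalence => Y hY.
have FG := Mmorphism_Gfunctor K (gT := gT) (tau_incl_Mmorphism (catM C)).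
have [X [f fm]] := catM_fixed_model (equivariant_functor_comp FG hY).
have [hX _ _] := fm; have [X' [e [tX' hX' ei he]]] := catM_tau_model tC hX.
exists (exist _ X' tX' : Csat C), (comp (c := catM C) f e).
apply: (fixed_model_reflect FG) hY _ _.
- exact: full_incl_full.
- exact: full_incl_faithful.
- exact: tau_fixed_ob.
- exact: fixed_model_comp fm hX' ei he.
Qed.

Let Hs (x : C) : finitely_supported (sfunctor C x) :=
  sfunctor_finitely_supported (tC x).

Lemma sfunctor_sat_full : full (sfunctor_sat Hs).
Proof. exact/full_corestrict_full/sfunctor_full. Qed.

Lemma sfunctor_sat_faithful : faithful (sfunctor_sat Hs).
Proof. exact/full_corestrict_faithful/sfunctor_faithful. Qed.

Lemma sfunctor_sat_equivalence : is_equivalence (sfunctor_sat Hs).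
Proof.
apply: is_equivalence_ff; [exact: sfunctor_sat_full|
  exact: sfunctor_sat_faithful|].
move=> [X tX]; have [f fi] := sfunctor_ess_surj X.
by exists (fob X 1M), f.
Qed.

Lemma sfunctor_sat_Mmorphism : is_Mmorphism (sfunctor_sat Hs).
Proof.
split=> [u x|v u x y f].
  by apply: eq_exist; exact: (sfunctor_Mmorphism C).1.
by apply: Csat_eqm; exact: (sfunctor_Mmorphism C).2.
Qed.

Lemma sfunctor_sat_global_equivalence :
  saturated K C -> global_equivalence K (sfunctor_sat Hs).
Proof.
move=> sC; exists sfunctor_sat_Mmorphism => gT.
apply: weak_equivalence_of_equivalence.
apply: fixed_map_equivalence; [exact: sfunctor_sat_full|
  exact: sfunctor_sat_faithful|].
move=> [X tX] hX.
have hX' : fixed_ob (X : eval_omegaG K (catM C) gT).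
  by move=> g; exact: (congr1 sval (hX g)).
have [x [f [hx fi hf]]] := sfunctor_fixed_model sC hX'.
exists x, f; split=> //.
exact: tau_fixed_hom.
Qed.

End Saturation.

Theorem theorem7p24 : forall (K : kappa_system) (C : Mcategory),
  is_Mmorphism (sfunctor C) /\
  saturated K (catM C) /\
  (tame C -> global_equivalence K (Csat_incl C)) /\
  (tame C ->
     saturated K (Csat C) /\
     exists Hs : forall x : C, finitely_supported (sfunctor C x),
       is_equivalence (sfunctor_sat Hs)) /\
  (tame C -> saturated K C ->
     exists Hs : forall x : C, finitely_supported (sfunctor C x),
       global_equivalence K (sfunctor_sat Hs)).
Proof.
move=> K C; split; first exact: sfunctor_Mmorphism.
split; first exact: catM_saturated.
split; first exact: Csat_incl_global_equivalence.
split=> [tC|tC sC].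
  split; first exact: Csat_saturated.
  exists (fun x => sfunctor_finitely_supported (tC x)).
  exact: sfunctor_sat_equivalence.
exists (fun x => sfunctor_finitely_supported (tC x)).
exact: sfunctor_sat_global_equivalence.
Qed.
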